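(* Let $n=2k\ell$, let $D\in\mathbb{C}^{n\times n}$ be a unitary diagonal matrix and let $U\in\mathbb{C}^{n\times k}$. Let $Q\in\mathbb{C}^{n\times n}$ be a unitary matrix such that $Q^H[\,U\ \ DU\,]$ is upper triangular and $B_R=Q^H\,\Re(D)\,Q$ is $2k$-banded (as obtained by applying the band reduction scheme to the diagonal matrix $\Re(D)$ and the rectangular matrix $[\,U\ \ DU\,]$). Assume that $\Re(D)$ satisfies the no-breakdown-condition related to $[\,U\ \ DU\,]$ and $Q^H$. Then: (i) $B_I=Q^H\,\Im(D)\,Q$ is $2k$-banded; (ii) $B=Q^HDQ$ is $2k$-banded and CMV structured with block size $k$.
   Context: $X^H$ is the conjugate transpose; $\Re(D)=\frac12(D+D^H)$, $\Im(D)=\frac1{2i}(D-D^H)$. A matrix $M=(m_{ij})$ is $2k$-banded if $m_{ij}=0$ for $|i-j|>2k$. A (possibly rectangular) matrix is upper triangular if its entries $(i,j)$ with $i>j$ vanish. No-breakdown-condition: a matrix $A\in\mathbb{C}^{n\times n}$ satisfies the no-breakdown-condition related to $W\in\mathbb{C}^{n\times p}$ and to a unitary $P\in\mathbb{C}^{n\times n}$ (with $n=ps$) if $PW$ is upper triangular of full rank, $H=PAP^H=(H_{i,j})_{1\le i,j\le s}$, $H_{i,j}\in\mathbb{C}^{p\times p}$, is block upper Hessenberg ($H_{i,j}=0$ for $i>j+1$), and the blocks $H_{j+1,j}$, $1\le j\le s-1$, are of full rank. Here it is used with $p=2k$, $W=[\,U\ \ DU\,]$, $P=Q^H$. CMV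 structure: a unitary matrix $A$ of size $n=2k\ell$, partitioned into $k\times k$ blocks $A_{p,q}$, $1\le p,q\le 2\ell$, is CMV structured with block size $k$ if it has the form $$A=\begin{bmatrix}\times&\times&L_3\\ R_1&\times&\times\\ &\times&\times&\times&L_5\\ &R_2&\times&\times&\times\\ &&&\times&\times&\ddots\\ &&&R_4&\times&\ddots\\ &&&&\ddots&\ddots\end{bmatrix}$$ with the $R_i$ nonsingular upper triangular and the $L_i$ nonsingular lower triangular $k\times k$ matrices and $\times$ arbitrary blocks. That is: for each $j=1,\dots,\ell$, the block rows $2j-1$ and $2j$ have nonzero blocks only in block columns $q$ with $2j-2\le q\le 2j+1$ (and $1\le q\le 2\ell$); $A_{2j-1,2j+1}=L_{2j+1}$ is nonsingular lower triangular for $1\le j\le \ell-1$; $A_{2,1}=R_1$ is nonsingular upper triangular; and $A_{2j,2j-2}=R_{2j-2}$ is nonsingular upper triangular for $2\le j\le\ell$. *)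

(* Defs.v *)
From mathcomp Require Import all_boot all_order all_algebra.
From mathcomp Require Import reals complex.

Set Implicit Arguments.
Unset Strict Implicit.
Unset Printing Implicit Defensive.

Import Order.TTheory GRing.Theory Num.Theory.
Local Open Scope ring_scope.
Local Open Scope sesquilinear_scope.

Definition mxRe (C : numClosedFieldType) (n : nat) (D : 'M[C]_n) : 'M[C]_n :=
  2^-1 *: (D + D ^t*).

Definition mxIm (C : numClosedFieldType) (n : nat) (D : 'M[C]_n) : 'M[C]_n :=
  (2 * 'i)^-1 *: (D - D ^t*).

Definition banded (K : fieldType) (n : nat) (w : nat) (M : 'M[K]_n) : Prop :=
  forall i j : 'I_n, ((i + w < j) || (j + w < i))%N -> M i j = 0.

(* is_trig_mx is the library's (rectangular) lower triangular predicate *)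
Definition upper_trig_mx (K : fieldType) (m n : nat) (M : 'M[K]_(m, n)) : bool :=
  is_trig_mx M^T.

Definition full_rank (K : fieldType) (m n : nat) (M : 'M[K]_(m, n)) : bool :=
  \rank M == minn m n.

Fact block_ord_subproof (n p s : nat) (hn : n = (p * s)%N) (i : 'I_s)
  (a : 'I_p) : (p * i + a < n)%N.
Proof.
rewrite hn; apply: (@leq_trans (p * i.+1)); last by rewrite leq_mul2l ltn_ord orbT.
by rewrite mulnS addnC ltn_add2r.
Qed.

Definition block_ord (n p s : nat) (hn : n = (p * s)%N) (i : 'I_s)
  (a : 'I_p) : 'I_n := Ordinal (block_ord_subproof hn i a).

(* Block (i, j), counted from 0, of the partition of A into s x s blocks of
   size p x p *)
Definition block (K : fieldType) (n p s : nat) (hn : n = (p * s)%N)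
  (A : 'M[K]_n) (i j : 'I_s) : 'M[K]_p :=
  mxsub (block_ord hn i) (block_ord hn j) A.

Definition no_breakdown (C : numClosedFieldType) (n p : nat)
  (A : 'M[C]_n) (W : 'M[C]_(n, p)) (P : 'M[C]_n) : Prop :=
  exists (s : nat) (hn : n = (p * s)%N),
    let H := block hn (P *m A *m P ^t*) in
    [/\ P \is unitarymx,
        upper_trig_mx (P *m W),
        full_rank (P *m W),
        (forall i j : 'I_s, (j.+1 < i)%N -> H i j = 0)
      & (forall i j : 'I_s, i = j.+1 :> nat -> full_rank (H i j))].

(* The block indices p, q : 'I_(2 * l) count from 0, so the conditions are
   written in terms of p.+1 and q.+1, which count from 1; j counts from 1. *)
Definition cmv_structured (C : numClosedFieldType) (n k l : nat)
  (A : 'M[C]_n) : Prop :=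
  exists hn : n = (k * (2 * l))%N,
    let B := block hn A in
    [/\ A \is unitarymx,
        (forall (j : nat) (p q : 'I_(2 * l)), (1 <= j <= l)%N ->
           (p.+1 = 2 * j - 1 \/ p.+1 = 2 * j)%N ->
           ~~ (2 * j - 2 <= q.+1 <= 2 * j + 1)%N -> B p q = 0),
        (forall (j : nat) (p q : 'I_(2 * l)), (1 <= j < l)%N ->
           (p.+1 = 2 * j - 1)%N -> (q.+1 = 2 * j + 1)%N ->
           is_trig_mx (B p q) /\ B p q \in unitmx),
        (forall p q : 'I_(2 * l), p.+1 = 2%N -> q.+1 = 1%N ->
           upper_trig_mx (B p q) /\ B p q \in unitmx)
      & (forall (j : nat) (p q : 'I_(2 * l)), (2 <= j <= l)%N ->
           (p.+1 = 2 * j)%N -> (q.+1 = 2 * j - 2)%N ->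
           upper_trig_mx (B p q) /\ B p q \in unitmx)].

(* Main.v *)
(* Put B = Q^H D Q, C = B^H = B^-1 and H = B + C = 2 B_R.  In terms of
   K = Q^H U, the first 2kj basis vectors span B^i K for -j < i <= j, and the
   first k(2j+1) span B^i K for -j <= i <= j, so multiplication by B or C only
   enlarges these spaces slowly.  Entrywise, counting blocks of size k from 0:
   in block column q, the rows of B (for q even) or of C (for q odd) vanish
   from block q + 2 on, and those of the other factor from block q + 3 on.
   Since C = B^H this bounds B on both sides of the diagonal, and the extreme
   blocks of B coincide with blocks of the 2k-banded matrix H, except R_1,
   which is read off from B K = Q^H D U. *)
Require Import Defs.
From mathcomp Require Import all_boot all_order all_algebra.
From mathcomp Require Import reals complex.
From mathcomp Require Import zify.

Set Implicit Arguments.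
Unset Strict Implicit.
Unset Printing Implicit Defensive.

Import Order.TTheory GRing.Theory Num.Theory.
Local Open Scope ring_scope.
Local Open Scope sesquilinear_scope.

(** * Triangular matrices: invertibility, rank and products *)

Lemma upper_trig_mxP (K : fieldType) (m n : nat) (M : 'M[K]_(m, n)) :
  reflect (forall (i : 'I_m) (j : 'I_n), (j < i)%N -> M i j = 0)
          (upper_trig_mx M).
Proof.
apply: (iffP is_trig_mxP) => hM i j hij; last by rewrite mxE hM.
by have := hM j i hij; rewrite mxE.
Qed.

Lemma trig_unitmx (K : fieldType) (n : nat) (M : 'M[K]_n) :
  is_trig_mx M -> (M \in unitmx) = [forall i, M i i != 0].
Proof.
move=> hM; rewrite unitmxE det_trig // unitfE.
apply/idP/forallP => [/prodf_neq0 h i | h]; first exact: h.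
by apply/prodf_neq0 => i _; apply: h.
Qed.

Lemma upper_trig_unitmx (K : fieldType) (n : nat) (M : 'M[K]_n) :
  upper_trig_mx M -> (M \in unitmx) = [forall i, M i i != 0].
Proof.
move=> hM; rewrite -unitmx_tr trig_unitmx //.
by apply: eq_forallb => i; rewrite mxE.
Qed.

(** The rows of [W] past the top square [T] vanish, so [W] factors through [T]; full column rank
    then makes [T] invertible. *)
Lemma full_rank_upper_trig_diag (K : fieldType) (n m : nat)
    (W : 'M[K]_(n, m)) :
  (m <= n)%N -> upper_trig_mx W -> full_rank W ->
  forall (x : 'I_n) (c : 'I_m), x = c :> nat -> W x c != 0.
Proof.
move=> le_mn /upper_trig_mxP hW /eqP rkW x c xc.
pose T : 'M_m := \matrix_(i, j) W (widen_ord le_mn i) j.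
pose E : 'M[K]_(n, m) := \matrix_(i, j) (i == j :> nat)%:R.
have WE : W = E *m T.
  apply/matrixP => i j; rewrite mxE.
  have [lt_im|le_mi] := ltnP i m.
    rewrite (bigD1 (Ordinal lt_im)) //= big1 => [|a ha]; last first.
      rewrite !mxE (_ : (i == a :> nat) = false) ?mul0r //.
      by apply/negbTE; apply: contraNneq ha => ia; apply/eqP/val_inj.
    by rewrite !mxE eqxx mul1r addr0; congr (W _ _); apply/val_inj.
  rewrite big1 ?hW // => [|a _]; first exact: leq_trans (ltn_ord j) le_mi.
  by rewrite !mxE gtn_eqF ?mul0r //; apply: leq_trans (ltn_ord a) le_mi.
have unitT : T \in unitmx.
  rewrite -row_free_unit /row_free eqn_leq rank_leq_row /=.
  by rewrite -{1}(minn_idPr le_mn) -rkW {1}WE mxrankM_maxr.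
have hT : upper_trig_mx T.
  by apply/upper_trig_mxP => i j ij; rewrite mxE hW.
move: unitT; rewrite upper_trig_unitmx // => /forallP/(_ c).
by rewrite mxE; congr (W _ _ != 0); apply/val_inj.
Qed.

(** The terms before [i] are killed by [M], those after [i] by [V]. This isolates one entry of [M]
    wherever [V i c] is nonzero. *)
Lemma mulmx_single (K : fieldType) (n m : nat) (M : 'M[K]_n)
    (V : 'M[K]_(n, m)) (r i : 'I_n) (c : 'I_m) :
  (forall x : 'I_n, (i < x)%N -> V x c = 0) ->
  (forall x : 'I_n, (x < i)%N -> M r x = 0) ->
  (M *m V) r c = M r i * V i c.
Proof.
move=> hV hM; rewrite mxE (bigD1 i) //= big1 ?addr0 // => x xi.
have [lt_xi|lt_ix|/val_inj e] := ltngtP x i; first by rewrite hM ?mul0r.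
- by rewrite hV ?mulr0.
- by rewrite e eqxx in xi.
Qed.

(** * Staircase zero pattern of a matrix and its inverse *)

Section Staircase.

(** [U] and [V] stand for Q^H U and Q^H D U, the two halves of one upper triangular matrix of full
    rank; hence the shift by [k] in the conditions on [V]. *)
Variables (K : fieldType) (n k : nat) (B C : 'M[K]_n) (U V : 'M[K]_(n, k)).
Hypotheses (hBC : B *m C = 1%:M) (hBU : B *m U = V).
Hypotheses (hU : forall (x : 'I_n) (c : 'I_k), (c < x)%N -> U x c = 0)
  (hU1 : forall (x : 'I_n) (c : 'I_k), x = c :> nat -> U x c != 0).
Hypotheses (hV : forall (x : 'I_n) (c : 'I_k), (k + c < x)%N -> V x c = 0)
  (hV1 : forall (x : 'I_n) (c : 'I_k), x = (k + c)%N :> nat -> V x c != 0).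
Hypotheses (hH : forall x y : 'I_n, (y + 2 * k < x)%N -> (B + C) x y = 0)
  (hH1 : forall x y : 'I_n, x = (y + 2 * k)%N :> nat -> (B + C) x y != 0).

(** Induction on the column: once the earlier columns of [B] vanish in row [r], the equation
    [B *m U = V] leaves only [B r i] times a nonzero diagonal entry of [U]. *)
Lemma first_block_zero (i r : 'I_n) :
  (i < k)%N -> (k + i < r)%N -> B r i = 0.
Proof.
have [m] := ubnP i; elim: m i => // m IH i le_im lt_ik lt_r.
have := mulmx_single (M := B) (V := U) (r := r) (i := i) (c := Ordinal lt_ik).
rewrite hBU => /(_ (fun x => @hU x (Ordinal lt_ik))) h.
have {}h : V r (Ordinal lt_ik) = B r i * U i (Ordinal lt_ik).
  by apply: h => x lt_xi; apply: IH; lia.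
apply/eqP; move/eqP: h; rewrite hV //= eq_sym mulf_eq0.
by rewrite (negbTE (hU1 (c := Ordinal lt_ik) _)) ?orbF.
Qed.

Lemma first_block_neq0 (i r : 'I_n) :
  (i < k)%N -> r = (k + i)%N :> nat -> B r i != 0.
Proof.
move=> lt_ik er.
have := mulmx_single (M := B) (V := U) (r := r) (i := i) (c := Ordinal lt_ik).
rewrite hBU => /(_ (fun x => @hU x (Ordinal lt_ik))) h.
have {}h : V r (Ordinal lt_ik) = B r i * U i (Ordinal lt_ik).
  by apply: h => x lt_xi; apply: first_block_zero; lia.
have : V r (Ordinal lt_ik) != 0 by apply: hV1.
by rewrite h mulf_eq0 negb_or => /andP[].
Qed.

Hypothesis k_gt0 : (0 < k)%N.

Local Notation X b := (if b then C else B).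

(** Three blocks instead of two put [r] more than [2 * k] below [i], wherever [i] sits in its block;
    there [B + C] is zero, so one summand vanishes with the other. *)
Lemma staircase_flip (i r : 'I_n) :
  ((k * (i %/ k + 2) <= r)%N -> X (odd (i %/ k)) r i = 0) ->
  (k * (i %/ k + 3) <= r)%N -> X (~~ odd (i %/ k)) r i = 0.
Proof.
move=> hX le_r; have lt_r : (i + 2 * k < r)%N.
  by have := ltn_ceil i k_gt0; lia.
have := hH lt_r; rewrite mxE.
have {hX le_r} := hX ltac:(lia).
by case: (odd _) => /= ->; rewrite ?addr0 ?add0r.
Qed.

(* For [X] one of [B] and [C] one has [X (B + C) = X X + 1]; evaluated in
   column [i - 2k] this expresses column [i] of [X] by the earlier ones. *)
Lemma staircase (i r : 'I_n) :
  (k * (i %/ k + 2) <= r)%N -> X (odd (i %/ k)) r i = 0.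
Proof.
have hCB := mulmx1C hBC.
have [m] := ubnP i; elim: m i r => // m IH i r le_im le_r.
(* If the blocks of [x] and [i] have different parity, [x] lies in a strictly earlier block, which
   pays for the extra block in [staircase_flip]. *)
have left0 (x : 'I_n) : (x < i)%N -> X (odd (i %/ k)) r x = 0.
  move=> lt_xi; have le_q : (x %/ k <= i %/ k)%N by rewrite leq_div2r // ltnW.
  have hx := IH x r (leq_trans lt_xi le_im).
  have [e|ne] := eqVneq (odd (x %/ k)) (odd (i %/ k)).
    by rewrite -e hx //; apply: leq_trans le_r;
      rewrite leq_mul2l leq_add2r le_q orbT.
  have -> : odd (i %/ k) = ~~ odd (x %/ k) by case: (odd _) (odd _) ne => [] [].
  apply: staircase_flip => //; apply: leq_trans le_r.
  have lt_q : (x %/ k < i %/ k)%N.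
    by rewrite ltn_neqAle le_q andbT; apply: contraNneq ne => ->.
  by rewrite leq_mul2l; lia.
have le_i := leq_trunc_div i k; have lt_i := ltn_ceil i k_gt0.
have lt_ir : (i < r)%N by nia.
have [lt_ik|le_ki] := ltnP i k.
  rewrite divn_small //= in le_r *.
  by apply: first_block_zero => //; lia.
(* In the second block column [C *m V = U] replaces the recursion: column [i - k] of [V] ends with a
   nonzero entry in row [i]. *)
have [lt_i2k|le_2ki] := ltnP i (2 * k).
  have q1 : (i %/ k = 1)%N by nia.
  rewrite q1 /= in left0 le_r *.
  have lt_c : (i - k < k)%N by lia.
  have CV : C *m V = U by rewrite -hBU mulmxA hCB mul1mx.
  have := mulmx_single (M := C) (V := V) (r := r) (i := i) (c := Ordinal lt_c).
  rewrite CV hU /=; last by lia.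
  move=> h; have {}h : 0 = C r i * V i (Ordinal lt_c).
    by apply: h => // x lt_ix; apply: hV => /=; lia.
  apply/eqP; move/eqP: h; rewrite eq_sym mulf_eq0.
  by rewrite (negbTE (hV1 _)) ?orbF //=; lia.
have lt_i' : (i - 2 * k < n)%N by apply: leq_ltn_trans (ltn_ord i); lia.
pose i' := Ordinal lt_i'.
have q' : (i' %/ k = i %/ k - 2)%N by rewrite /= divnBMl.
have q2 : (2 <= i %/ k)%N by nia.
have odd_q : odd (i' %/ k) = odd (i %/ k) by rewrite q' oddB // addbF.
have lt_i'i : (i' < i)%N by rewrite /=; lia.
(* In the square of the factor, terms with [x < i] vanish by [left0], the others by induction at
   column [i'], whose zeros start at row [k * (i %/ k)]. *)
have XH : (X (odd (i %/ k)) *m (B + C)) r i' = 0.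
  have -> : X (odd (i %/ k)) *m (B + C) =
            X (odd (i %/ k)) *m X (odd (i %/ k)) + 1%:M.
    by rewrite mulmxDr; case: (odd _); rewrite ?hCB ?hBC // addrC.
  rewrite 2!mxE big1 ?add0r => [|x _]; last first.
    have [lt_xi|le_ix] := ltnP x i; first by rewrite left0 // mul0r.
    have := IH i' x; rewrite odd_q => ->; rewrite ?mulr0 //; first by lia.
    by rewrite q' subnK //; nia.
  by rewrite mxE -val_eqE gtn_eqF //; apply: ltn_trans lt_i'i lt_ir.
(* Column [i'] of [B + C] ends with a nonzero entry in row [i], so the product reduces to that entry
   times the one sought. *)
apply/eqP; move/eqP: XH; rewrite (mulmx_single (i := i)) //.
  by rewrite mulf_eq0 (negbTE (hH1 _)) ?orbF //=; lia.
by move=> x lt_ix; apply: hH => /=; lia.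
Qed.

Lemma staircase_other (i r : 'I_n) :
  (k * (i %/ k + 3) <= r)%N -> X (~~ odd (i %/ k)) r i = 0.
Proof. by apply: staircase_flip; apply: staircase. Qed.

End Staircase.

(** * Extreme diagonals and the CMV block pattern *)

Lemma full_rank_block_subdiag (K : fieldType) (n p s : nat)
    (hn : n = (p * s)%N) (M : 'M[K]_n) :
  banded p M ->
  (forall i j : 'I_s, i = j.+1 :> nat -> full_rank (block hn M i j)) ->
  forall x y : 'I_n, x = (y + p)%N :> nat -> M x y != 0.
Proof.
move=> hM rkM x y xy.
have lt_xn : (y + p < p * s)%N by rewrite -hn -xy.
have p_gt0 : (0 < p)%N by lia.
have lt_j : (y %/ p < s)%N.
  by rewrite ltn_divLR // mulnC; lia.
have lt_i : ((y %/ p).+1 < s)%N.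
  rewrite -(ltn_pmul2l p_gt0) mulnS; apply: leq_ltn_trans lt_xn.
  by rewrite addnC leq_add2r mulnC leq_trunc_div.
pose i := Ordinal lt_i; pose j := Ordinal lt_j.
pose a := Ordinal (ltn_pmod y p_gt0).
have ey := divn_eq y p.
have yE : y = block_ord hn j a by apply/val_inj; rewrite /= mulnC.
have xE : x = block_ord hn i a by apply/val_inj; rewrite /= xy; lia.
(* The band condition makes this block upper triangular, and its diagonal is a piece of the [p]-th
   subdiagonal of [M]. *)
have := rkM i j erefl; rewrite /full_rank minnn -/(row_free _) row_free_unit.
rewrite upper_trig_unitmx => [/forallP/(_ a)|]; first by rewrite mxE -xE -yE.
by apply/upper_trig_mxP => b c cb; rewrite mxE hM //= orbC;
  apply/orP; left; lia.
Qed.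

Lemma divn_block_ord (n p s : nat) (hn : n = (p * s)%N) (i : 'I_s) (a : 'I_p) :
  (block_ord hn i a %/ p = i)%N.
Proof.
have p_gt0 : (0 < p)%N by case: p a {hn} => [[]|].
by rewrite /= mulnC divnMDl // divn_small ?addn0.
Qed.

Lemma cmv_structured_of_banded_add (C : numClosedFieldType) (n k l : nat)
    (hn : n = (k * (2 * l))%N) (B : 'M[C]_n) (U V : 'M[C]_(n, k)) :
  B \is unitarymx -> B *m U = V ->
  (forall (x : 'I_n) (c : 'I_k), (c < x)%N -> U x c = 0) ->
  (forall (x : 'I_n) (c : 'I_k), x = c :> nat -> U x c != 0) ->
  (forall (x : 'I_n) (c : 'I_k), (k + c < x)%N -> V x c = 0) ->
  (forall (x : 'I_n) (c : 'I_k), x = (k + c)%N :> nat -> V x c != 0) ->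
  banded (2 * k) (B + B ^t*) ->
  (forall x y : 'I_n, x = (y + 2 * k)%N :> nat -> (B + B ^t*) x y != 0) ->
  banded (2 * k) B /\ cmv_structured k l B.
Proof.
move=> uB hBU hU hU1 hV hV1 hH hH1.
have hBC : B *m B ^t* = 1%:M by apply/unitarymxP.
have hHl (x y : 'I_n) : (y + 2 * k < x)%N -> (B + B ^t*) x y = 0.
  by move=> h; apply: hH; rewrite h orbT.
(* If [k] were 0, then [n] would be 0 and no index could exist. *)
have gt0 (x : 'I_n) : (0 < k)%N.
  by case: k hn x {hBU hU hU1 hV hV1 hH hH1 hHl U V} => // -> [].
have CE (x y : 'I_n) : (B ^t*) x y = (B y x)^* by rewrite !mxE.
have st (i r : 'I_n) :=
  staircase hBC hBU hU hU1 hV hV1 hHl hH1 (gt0 i)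
    (i := i) (r := r).
have so (i r : 'I_n) :=
  staircase_other hBC hBU hU hU1 hV hV1 hHl hH1 (gt0 i)
    (i := i) (r := r).
have le_div (x : 'I_n) q : (q <= x %/ k)%N -> (k * q <= x)%N.
  by move=> h; rewrite mulnC (leq_trans _ (leq_trunc_div x k)) //
    leq_mul2r h orbT.
have low_even (x y : 'I_n) : ~~ odd (y %/ k) ->
    (y %/ k + 2 <= x %/ k)%N -> B x y = 0.
  by move=> /negbTE ey /le_div /st; rewrite ey.
have low_odd (x y : 'I_n) : odd (y %/ k) ->
    (y %/ k + 3 <= x %/ k)%N -> B x y = 0.
  by move=> oy /le_div /so; rewrite oy.
(* Zeros in the columns of the adjoint, conjugated, become zeros in the rows of [B]. *)
have up_even (x y : 'I_n) : ~~ odd (x %/ k) ->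
    (x %/ k + 3 <= y %/ k)%N -> B x y = 0.
  by move=> ex /le_div /so; rewrite ex CE => /eqP; rewrite conjC_eq0 => /eqP.
have up_odd (x y : 'I_n) : odd (x %/ k) ->
    (x %/ k + 2 <= y %/ k)%N -> B x y = 0.
  by move=> ox /le_div /st; rewrite ox CE => /eqP; rewrite conjC_eq0 => /eqP.
(* Where the adjoint vanishes, [B] inherits both the bandwidth and the nonzero extreme diagonal of
   the sum. *)
have subE (x y : 'I_n) : odd (y %/ k) -> (y %/ k + 2 <= x %/ k)%N ->
    B x y = (B + B ^t*) x y.
  by move=> oy le; rewrite mxE CE (up_odd y x) // conjC0 addr0.
have supE (x y : 'I_n) : ~~ odd (x %/ k) -> (x %/ k + 2 <= y %/ k)%N ->
    B x y = (B + B ^t*) x y.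
  by move=> ox le; rewrite mxE CE (low_even y x) // conjC0 addr0.
have hH2 (x y : 'I_n) : y = (x + 2 * k)%N :> nat -> (B + B ^t*) x y != 0.
  by move/hH1; rewrite !mxE -(conjC_eq0 (_ + _)) rmorphD /= conjCK addrC.
have le_div2 (x y : 'I_n) : (x + 2 * k < y)%N -> (x %/ k + 2 <= y %/ k)%N.
  move=> /ltnW h; rewrite addnC -(divnMDl _ _ (gt0 x)) leq_div2r //.
  by rewrite addnC.
split.
  move=> x y /orP[] lt_xy; have le_q := le_div2 _ _ lt_xy.
    have [ox|ex] := boolP (odd (x %/ k)); first exact: up_odd.
    by rewrite supE // hH // lt_xy.
  have [oy|ey] := boolP (odd (y %/ k)); last exact: low_even.
  by rewrite subE // hH // lt_xy orbT.
exists hn; split=> //.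
(* Since [p] counts from 0, block row [2 * j - 1] has even [p] and block row [2 * j] has odd [p]. *)
- move=> j p q hj hp hq; apply/matrixP => a b; rewrite !mxE.
  have xk := divn_block_ord hn p a; have yk := divn_block_ord hn q b.
  have [lt_q|le_q] := ltnP (2 * j) q.
    by case: hp => hp; [apply: up_even|apply: up_odd]; rewrite xk ?yk; lia.
  by have [oq|eq] := boolP (odd q); [apply: low_odd|apply: low_even];
    rewrite ?xk yk; lia.
- move=> j p q hj hp hq.
  have BE a b : block hn B p q a b =
      (B + B ^t*) (block_ord hn p a) (block_ord hn q b).
    by rewrite mxE supE // !divn_block_ord; lia.
  have tr : is_trig_mx (block hn B p q).
    by apply/is_trig_mxP => a b lt_ab; rewrite BE hH //=; lia.
  split=> //; rewrite trig_unitmx //; apply/forallP => a.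
  by rewrite BE hH2 //=; lia.
(* The adjoint need not vanish on this block, so [R_1] comes from [B *m U = V] and not from the
   sum. *)
- move=> p q hp hq.
  have tr : upper_trig_mx (block hn B p q).
    apply/upper_trig_mxP => a b lt_ba; rewrite mxE.
    by apply: (first_block_zero hBU) => //=; have := ltn_ord b; nia.
  split=> //; rewrite upper_trig_unitmx //; apply/forallP => a; rewrite mxE.
  by apply: (first_block_neq0 hBU) => //=; have := ltn_ord a; nia.
- move=> j p q hj hp hq.
  have BE a b : block hn B p q a b =
      (B + B ^t*) (block_ord hn p a) (block_ord hn q b).
    by rewrite mxE subE // !divn_block_ord; lia.
  have tr : upper_trig_mx (block hn B p q).
    by apply/upper_trig_mxP => a b lt_ba; rewrite BE hH //=; lia.
  split=> //; rewrite upper_trig_unitmx //; apply/forallP => a.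
  by rewrite BE hH1 //=; lia.
Qed.

Theorem lemma3p8 (R : realType) (n k l : nat) (hn : n = (2 * k * l)%N)
  (D : 'M[R[i]]_n) (U : 'M[R[i]]_(n, k)) (Q : 'M[R[i]]_n)
  (hDdiag : is_diag_mx D) (hDunit : D \is unitarymx)
  (hQunit : Q \is unitarymx)
  (hQW : upper_trig_mx (Q ^t* *m row_mx U (D *m U)))
  (hBR : banded (2 * k) (Q ^t* *m mxRe D *m Q))
  (hnb : no_breakdown (mxRe D) (row_mx U (D *m U)) (Q ^t*)) :
  banded (2 * k) (Q ^t* *m mxIm D *m Q) /\
  (banded (2 * k) (Q ^t* *m D *m Q) /\
   cmv_structured k l (Q ^t* *m D *m Q)).
Proof.
case: hnb => s [hs /=]; rewrite trmxCK => -[_ _ rkW _ rkH].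
have two0 : (2%:R : R[i]) != 0 by rewrite pnatr_eq0.
pose B := Q ^t* *m D *m Q.
have BtE : B ^t* = Q ^t* *m D ^t* *m Q.
  by rewrite /B !trmx_mul !map_mxM /= trmxCK mulmxA.
have ReE : Q ^t* *m mxRe D *m Q = 2^-1 *: (B + B ^t*).
  by rewrite BtE /mxRe -scalemxAr -scalemxAl mulmxDr mulmxDl.
have ImE : Q ^t* *m mxIm D *m Q = (2 * 'i)^-1 *: (B - B ^t*).
  by rewrite BtE /mxIm -scalemxAr -scalemxAl mulmxBr mulmxBl.
have uB : B \is unitarymx by rewrite !mul_unitarymx // trmxC_unitary.
have hH : banded (2 * k) (B + B ^t*).
  move=> x y /hBR /eqP; rewrite ReE mxE mulf_eq0 invr_eq0 (negbTE two0).
  by move/eqP.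
have hH1 (x y : 'I_n) : x = (y + 2 * k)%N :> nat -> (B + B ^t*) x y != 0.
  (* The block size in [hnb] is the column count [k + k] of the [row_mx], only propositionally equal
     to [2 * k]. *)
  move=> xy; have kk : (k + k = 2 * k)%N by lia.
  have hBR' : banded (k + k) (Q ^t* *m mxRe D *m Q) by rewrite kk.
  have /(_ x y) := full_rank_block_subdiag hBR' rkH.
  by rewrite kk ReE mxE mulf_eq0 negb_or => /(_ xy) /andP[].
have WE : Q ^t* *m row_mx U (D *m U) = row_mx (Q ^t* *m U) (B *m (Q ^t* *m U)).
  rewrite mul_mx_row; congr row_mx; rewrite /B mulmxA -(mulmxA _ Q).
  by rewrite (unitarymxP hQunit) mulmx1 mulmxA.
rewrite WE in hQW rkW; move/upper_trig_mxP: (hQW) => W0.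
have W1 le := full_rank_upper_trig_diag le hQW rkW.
(* An index excludes [l = 0], so [n] is at least [2 * k]. *)
have le_kn (x : 'I_n) : (k + k <= n)%N.
  by case: l hn x => [|l' ->]; [rewrite muln0 => -> []|move=> _; nia].
have [bB cB] : banded (2 * k) B /\ cmv_structured k l B.
  apply: (@cmv_structured_of_banded_add _ _ _ _ _ _ (Q ^t* *m U) _ uB erefl
            _ _ _ _ hH hH1).
  - by rewrite hn; lia.
  - by move=> x c h; have := W0 x (lshift k c) h; rewrite row_mxEl.
  - by move=> x c h; have := W1 (le_kn x) x (lshift k c) h; rewrite row_mxEl.
  - by move=> x c h; have := W0 x (rshift k c) h; rewrite row_mxEr.
  - by move=> x c h; have := W1 (le_kn x) x (rshift k c) h; rewrite row_mxEr.
split; last by split.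
(* Part (i) follows from (ii): the band is symmetric, so the adjoint of [B] is banded as well. *)
move=> x y h; rewrite {}ImE; clearbody B.
rewrite !mxE bB // bB ?conjC0 ?subrr ?mulr0 //.
by rewrite orbC.
Qed.
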